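(* Let $d\ge1$, $k\ge1$, and let $\mathcal S_{\mathrm a}$ be a convergent $d$-variate subdivision scheme with (real, finitely supported) mask $\mathrm a$. Then $\mathcal S_{\mathrm a}$ satisfies Condition $\mathrm Z_k$ if and only if its mask symbol can be written as a finite sum $$\mathrm a(\boldsymbol z)=\sum_j\lambda_j\;\sigma_j(\boldsymbol z)\;2^d\,Q_j(\boldsymbol z),$$ where the $Q_j(\boldsymbol z)$ are $k$-fold products of polynomials $q_\Theta$ with unimodular $d\times d$-submatrices $\Theta$ of $X_d$, the $\sigma_j(\boldsymbol z)$ are Laurent polynomials normalized by $\sigma_j(\boldsymbol 1)=1$, and the $\lambda_j$ are real numbers with $\sum_j\lambda_j=1$.
   Context: A mask is a finitely supported sequence $\mathrm a=(\mathrm a_\alpha)_{\alpha\in\mathbb Z^d}$ of real numbers. The associated subdivision operator acts on sequences $\mathrm d=(\mathrm d_\alpha)_{\alpha\in\mathbb Z^d}$ by $(\mathcal S_{\mathrm a}\mathrm d)_\alpha=\sum_{\beta\in\mathbb Z^d}\mathrm d_\beta\,\mathrm a_{\alpha-2\beta}$. The mask symbol is the Laurent polynomial $\mathrm a(\boldsymbol z)=\sum_{\alpha\in\mathbb Z^d}\mathrm a_\alpha\boldsymbol z^\alpha$, $\boldsymbol z\in(\mathbb C\setminus\{0\})^d$, with $\boldsymbol z^\alpha=z_1^{\alpha_1}\cdots z_d^{\alpha_d}$. The scheme is convergent if for every $\mathrm d\in\ell_\infty(\mathbb Z^d)$ there is a uniformly continuous function $f_{\mathrm d}$ on $\mathbb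 R^d$ with $\lim_{r\to\infty}\sup_{\alpha\in\mathbb Z^d}|(\mathcal S_{\mathrm a}^r\mathrm d)_\alpha-f_{\mathrm d}(2^{-r}\alpha)|=0$, and $f_{\mathrm d}\ne0$ for some $\mathrm d$. Condition $\mathrm Z_k$ (zero condition of order $k$): $\mathrm a(\boldsymbol 1)=2^d$ and $(D^{\mathbf j}\mathrm a)(\varepsilon)=0$ for all $\varepsilon\in\{-1,+1\}^d\setminus\{\boldsymbol 1\}$ and all multi-indices $\mathbf j\in\mathbb N_0^d$ with $|\mathbf j|<k$, where $D^{\mathbf j}$ denotes the partial derivative of order $\mathbf j$ and $\boldsymbol1=(1,\dots,1)$. $X_d$ is the $d\times(2^d-1)$ matrix whose columns are all the nonzero vectors in $\{0,1\}^d$. A $d\times d$-submatrix is obtained by selecting $d$ distinct columns; it is unimodular if $\det\Theta=\pm1$. For such $\Theta$, $q_\Theta(\boldsymbol z)=\prod_{\theta\in\Theta}\frac{1+\boldsymbol z^\theta}{2}$, where $\theta$ runs through the columns of $\Theta$. Laurent polynomials are taken with real coefficients. *)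

(* Defs.v *)
From HB Require Import structures.
From mathcomp Require Export all_boot all_order all_algebra finmap.
From mathcomp Require Export all_classical all_reals all_analysis.
From mathcomp Require Export complex.
Export Order.TTheory GRing.Theory Num.Theory numFieldNormedType.Exports.

Set Implicit Arguments.
Unset Strict Implicit.
Unset Printing Implicit Defensive.

Local Open Scope classical_set_scope.
Local Open Scope ring_scope.
Local Open Scope complex_scope.

(* Elements of Z^d, R^d and C^d are column vectors. A finitely supported real
   sequence indexed by Z^d serves both as a mask and as the coefficient sequence
   of a Laurent polynomial with real coefficients. *)
Definition laurent (R : realType) (d : nat) := {fsfun 'cV[int]_d -> R with 0}.

Section Symbol.
Variables (R : realType) (d : nat).
Implicit Types (z : 'cV[R[i]]_d) (alpha : 'cV[int]_d) (a : laurent R d).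

Definition torus z : Prop := forall i, z i 0 != 0.

Definition monomial z alpha : R[i] := \prod_(i < d) z i 0 ^ alpha i 0.

(* The Laurent polynomial function of a; only its values on [torus] matter. *)
Definition symbol a z : R[i] :=
  \sum_(alpha <- finsupp a) (a alpha)%:C * monomial z alpha.

End Symbol.

(* D^j f, with all the derivatives in one coordinate taken consecutively. *)
Definition mixed_partial (K : numFieldType) (d : nat) (j : 'I_d -> nat)
    (f : 'cV[K]_d -> K) : 'cV[K]_d -> K :=
  foldr (fun i g => iter (j i) (fun h z => 'D_(delta_mx i 0) h z) g)
    f (enum 'I_d).

Definition condZ (R : realType) (d k : nat) (a : laurent R d) : Prop :=
  symbol a (const_mx 1) = 2 ^+ d /\
  forall eps : 'cV[R[i]]_d,
    (forall i, eps i 0 = 1 \/ eps i 0 = -1) -> eps <> const_mx 1 ->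
  forall j : 'I_d -> nat, (\sum_(i < d) j i < k)%N ->
    @mixed_partial R[i] d j (symbol a) eps = 0.

Section Subdivision.
Variables (R : realType) (d : nat).
Implicit Types (a : laurent R d) (u : 'cV[int]_d -> R) (f : 'cV[R]_d -> R).

(* The family summed over beta is finitely supported because a is. *)
Definition subdivision a u : 'cV[int]_d -> R :=
  fun alpha => \sum_(beta \in [set: 'cV[int]_d]) u beta * a (alpha - beta *+ 2).

Definition l_infty u : Prop := exists M : R, forall alpha, `|u alpha| <= M.

Definition dyadic_point (r : nat) (alpha : 'cV[int]_d) : 'cV[R]_d :=
  2 ^- r *: map_mx intr alpha.

(* The supremum is taken in the extended reals, so that an unbounded
   difference counts as +oo. *)
Definition subdivision_limit a u f : Prop :=
  unif_continuous f /\
  ereal_sup [set (`|iter r (subdivision a) u alpha - f (dyadic_point r alpha)|)%:E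
            | alpha in [set: 'cV[int]_d]] @[r --> \oo] --> 0%E.

Definition convergent a : Prop :=
  (forall u, l_infty u -> exists f, subdivision_limit a u f) /\
  (exists u f, [/\ l_infty u, subdivision_limit a u f & exists x, f x != 0]).

End Subdivision.

Definition nonzero_binary (d : nat) : {set 'cV[bool]_d} :=
  [set v | v != const_mx false].

(* The number of columns is 2 ^ d - 1, see [card_nonzero_binary]. *)
Definition Xmx (d : nat) : 'M[int]_(d, #|nonzero_binary d|) :=
  \matrix_(i, j) ((enum_val j : 'cV[bool]_d) i 0 : nat)%:Z.

Lemma card_nonzero_binary (d : nat) : #|nonzero_binary d| = (2 ^ d - 1)%N.
Proof.
have -> : nonzero_binary d = (~: [set const_mx false])%SET.
  by apply/setP => v; rewrite !inE.
by rewrite cardsC1 card_mx card_bool muln1 subn1.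
Qed.

Definition submatrix_of_X (d : nat) (Theta : 'M[int]_d) : Prop :=
  exists2 s : 'I_d -> 'I_#|nonzero_binary d|,
    injective s & Theta = colsub s (Xmx d).

Definition unimodular (d : nat) (Theta : 'M[int]_d) : Prop :=
  \det Theta = 1 \/ \det Theta = -1.

Definition qpoly (R : realType) (d : nat) (Theta : 'M[int]_d)
    (z : 'cV[R[i]]_d) : R[i] :=
  \prod_(l < d) ((1 + monomial z (col l Theta)) / 2).

(* Main.v *)
From HB Require Import structures.
Require Import Defs.
From mathcomp Require Import ring zify.

Set Implicit Arguments.
Unset Strict Implicit.
Unset Printing Implicit Defensive.

Local Open Scope ring_scope.
Local Open Scope complex_scope.

(** Let A be the ring of Laurent polynomials with real coefficients, m_eps the
    ideal of a point eps of {-1, 1}^d, and q the ideal generated by the q_Theta.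
    Up to the value at the point 1, Condition Z_k says that the symbol belongs
    to m_eps^k for every eps other than 1; a decomposition says that it belongs
    to q^k. So the heart of the matter is that q^k is the intersection of the
    m_eps^k.

    Derivatives and ideals ([point_ideal_mixed_partial]). A derivation maps
    m_eps^k into m_eps^(k-1), so elements of m_eps^k vanish to order k at eps.
    Conversely, for f in m_eps^k Euler's identity
      sum_i (z_i - eps_i) D_i f = k f   modulo m_eps^(k+1)
    gives, by induction on k, that an f vanishing to order k + 1 lies in
    m_eps^(k+1), since each D_i f vanishes to order k; the induction starts at
    order 1 with f - f(eps) in m_eps ([point_ideal_const]).

    q^k is in m_eps^k ([qpoly_sign_point]). A unimodular Theta is invertible
    modulo 2, so for eps = (-1)^b with b nonzero some exponent theta . b is odd
    and the factor 1 + z^theta of q_Theta vanishes at eps.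

    The converse ([vanishing_box_ideal]). Put
    E_eps = prod_i (1 + eps_i z_i) / 2, which vanishes at every sign point but
    eps. Since (1 + z_i) / 2 and (1 - z_i) / 2 are comaximal, so are the powers
    of the E_eps: 1 = sum_eps c_eps E_eps^(d k). Hence it suffices to put each
    E_eps^(d k) f in q^k. For eps = 1 this is clear because E_1 is q_Theta for
    the identity matrix. For eps different from 1, f is a combination of k-fold
    products of the z_i - eps_i, and it suffices that (z_i - eps_i) E_eps^d
    belongs to q ([bump_at_linear]). That is seen by fixing s with eps_s = -1
    and rewriting with
      (1 - z_s) (1 - z_j) = 2 (1 + z_s z_j) - (1 + z_s) (1 + z_j);
    expanding the product over j yields multiples of q_Theta for matrices
    Theta whose columns are e_j or e_j + e_s for j other than s, and
    e_s or e_s + e_t in position s ([box_ideal_core]).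

    Finally the cofactors of the k-fold products are normalized by writing
    tau = 1 (tau - tau(1) + 1) + (tau(1) - 1) 1; evaluation at the point 1 then
    shows that the weights add up to one ([box_ideal_normal_form]). *)

(** * Laurent polynomial functions and their derivatives *)

(** Locked, so that unification never compares two partial derivatives by
    unfolding them down to limits. *)
HB.lock Definition partial (R : realType) (d : nat) (i : 'I_d)
    (f : 'cV[(R[i] : numFieldType)]_d -> (R[i] : numFieldType)) :
    'cV[(R[i] : numFieldType)]_d -> (R[i] : numFieldType) :=
  fun z => 'D_(delta_mx i 0) f z.
Canonical partial_unlockable := Unlockable partial.unlock.

Section LaurentFunctions.
Variables (R : realType) (d : nat).
Notation K := (R[i] : numFieldType).
Implicit Types (f g : 'cV[K]_d -> K) (z : 'cV[K]_d) (i : 'I_d).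

(** Functions that agree on the torus with the symbol of some mask, see
    [laurent_funP]. The inductive form gives the closure properties for free and
    reduces facts on derivatives to coordinates, sums and products. *)
Inductive laurent_fun : ('cV[K]_d -> K) -> Prop :=
| laurentC (c : R) : laurent_fun (fun=> c%:C)
| laurentX i : laurent_fun (fun z => z i 0)
| laurentV i : laurent_fun (fun z => (z i 0)^-1)
| laurentD f g : laurent_fun f -> laurent_fun g ->
    laurent_fun (fun z => f z + g z)
| laurentM f g : laurent_fun f -> laurent_fun g ->
    laurent_fun (fun z => f z * g z)
| laurent_ext f g : laurent_fun f -> (forall z, torus z -> g z = f z) ->
    laurent_fun g.

Lemma laurent1 : laurent_fun (fun=> 1).
Proof. exact: laurent_ext (laurentC 1) _. Qed.

Lemma laurent0 : laurent_fun (fun=> 0).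
Proof. exact: laurent_ext (laurentC 0) _. Qed.

Lemma laurent_half : laurent_fun (fun=> 2^-1).
Proof.
by apply: laurent_ext (laurentC 2^-1) _ => z _; rewrite fmorphV rmorph_nat.
Qed.

Lemma laurentN f : laurent_fun f -> laurent_fun (fun z => - f z).
Proof.
move=> lf; apply: laurent_ext (laurentM (laurentC (-1)) lf) _ => z _.
by rewrite rmorphN1 mulN1r.
Qed.

Lemma laurentB f g : laurent_fun f -> laurent_fun g ->
  laurent_fun (fun z => f z - g z).
Proof. by move=> lf lg; apply: laurentD lf (laurentN lg). Qed.

Lemma laurent_sum (I : Type) (s : seq I) (P : pred I) F :
  (forall x, P x -> laurent_fun (F x)) ->
  laurent_fun (fun z => \sum_(x <- s | P x) F x z).
Proof.
move=> lF; elim: s => [|x s IH].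
  by apply: laurent_ext laurent0 _ => z _; rewrite big_nil.
case Px : (P x); last first.
  by apply: laurent_ext IH _ => z _; rewrite big_cons Px.
by apply: laurent_ext (laurentD (lF _ Px) IH) _ => z _; rewrite big_cons Px.
Qed.

Lemma laurent_prod (I : Type) (s : seq I) (P : pred I) F :
  (forall x, P x -> laurent_fun (F x)) ->
  laurent_fun (fun z => \prod_(x <- s | P x) F x z).
Proof.
move=> lF; elim: s => [|x s IH].
  by apply: laurent_ext laurent1 _ => z _; rewrite big_nil.
case Px : (P x); last first.
  by apply: laurent_ext IH _ => z _; rewrite big_cons Px.
by apply: laurent_ext (laurentM (lF _ Px) IH) _ => z _; rewrite big_cons Px.
Qed.

Lemma laurent_exp f n : laurent_fun f -> laurent_fun (fun z => f z ^+ n).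
Proof.
move=> lf; elim: n => [|n IH]; first exact: laurent_ext laurent1 _.
by apply: laurent_ext (laurentM lf IH) _ => z _; rewrite exprS.
Qed.

Lemma laurent_monomial alpha : laurent_fun (fun z => monomial z alpha).
Proof.
apply: laurent_prod => i _; case: (alpha i 0) => n.
  exact: laurent_exp (laurentX i).
apply: laurent_ext (laurent_exp n.+1 (laurentV i)) _ => z _.
by rewrite NegzE -exprnN exprVn.
Qed.

Lemma laurent_symbol (a : laurent R d) : laurent_fun (symbol a).
Proof.
apply: laurent_sum => alpha _.
exact: laurentM (laurentC _) (laurent_monomial _).
Qed.

Lemma symbol_sum (a : laurent R d) (F : {fset 'cV[int]_d}) z :
  (finsupp a `<=` F)%fset ->
  symbol a z = \sum_(alpha <- F) (a alpha)%:C * monomial z alpha.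
Proof.
move=> sF; rewrite /symbol; apply: big_fset_incl => // alpha _ na.
by rewrite (fsfun_dflt na) rmorph0 mul0r.
Qed.

Lemma symbol_scaled_monomial (c : R) alpha :
  exists a : laurent R d, forall z, symbol a z = c%:C * monomial z alpha.
Proof.
exists [fsfun x in [fset alpha]%fset => c] => z.
rewrite (symbol_sum (F := [fset alpha]%fset)) ?finsupp_sub //.
by rewrite big_seq_fset1 fsfun_fun inE eqxx.
Qed.

Lemma symbol_add (a b : laurent R d) :
  exists c : laurent R d, forall z, symbol c z = symbol a z + symbol b z.
Proof.
pose F := (finsupp a `|` finsupp b)%fset.
exists [fsfun x in F => a x + b x] => z.
rewrite (symbol_sum (F := F)) ?finsupp_sub //.
rewrite (@symbol_sum a F) ?fsubsetUl // (@symbol_sum b F) ?fsubsetUr //.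
rewrite -big_split /= big_seq [RHS]big_seq; apply: eq_bigr => x xF.
by rewrite fsfun_fun xF rmorphD mulrDl.
Qed.

Lemma symbol_big_sum (I : Type) (s : seq I) (F : I -> 'cV[K]_d -> K) :
  (forall x, exists a : laurent R d, forall z, torus z -> F x z = symbol a z) ->
  exists a : laurent R d,
    forall z, torus z -> \sum_(x <- s) F x z = symbol a z.
Proof.
move=> HF; elim: s => [|x s [a IH]].
  have [a Ha] := symbol_scaled_monomial 0 0.
  by exists a => z _; rewrite Ha big_nil rmorph0 mul0r.
have [b Hb] := HF x; have [c Hc] := symbol_add b a.
by exists c => z tz; rewrite big_cons Hc Hb // IH.
Qed.

Lemma monomialD z alpha beta : torus z ->
  monomial z (alpha + beta) = monomial z alpha * monomial z beta.
Proof.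
move=> tz; rewrite /monomial -big_split; apply: eq_bigr => i _ /=.
by rewrite mxE expfzDr.
Qed.

Lemma monomial_delta z i (n : int) : monomial z (n *: delta_mx i 0) = z i 0 ^ n.
Proof.
rewrite /monomial (bigD1 i) //= big1 => [|j /negPf ji]; last first.
  by rewrite !mxE ji mulr0.
by rewrite !mxE !eqxx !mulr1.
Qed.

Lemma laurent_funP f : laurent_fun f ->
  exists a : laurent R d, forall z, torus z -> f z = symbol a z.
Proof.
elim=> {f} [c|i|i|f g _ [a Ha] _ [b Hb]|f g _ [a Ha] _ [b Hb]|f g _ [a Ha] fg].
- have [a Ha] := symbol_scaled_monomial c 0.
  exists a => z _; rewrite Ha /monomial big1 ?mulr1 // => i _.
  by rewrite mxE expr0z.
- have [a Ha] := symbol_scaled_monomial 1 (1 *: delta_mx i 0).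
  by exists a => z _; rewrite Ha monomial_delta mul1r expr1z.
- have [a Ha] := symbol_scaled_monomial 1 (-1 *: delta_mx i 0).
  by exists a => z _; rewrite Ha monomial_delta mul1r exprN1.
- have [c Hc] := symbol_add a b.
  by exists c => z tz; rewrite Hc Ha // Hb.
- have [c Hc] : exists c : laurent R d, forall z, torus z ->
      \sum_(x <- finsupp a) \sum_(y <- finsupp b)
        ((a x)%:C * monomial z x) * ((b y)%:C * monomial z y) = symbol c z.
    apply: symbol_big_sum => x; apply: symbol_big_sum => y.
    have [c Hc] := symbol_scaled_monomial (a x * b y) (x + y).
    by exists c => z tz; rewrite Hc monomialD // rmorphM /= mulrACA.
  exists c => z tz; rewrite -Hc // Ha // Hb // {1}/symbol mulr_suml.
  by apply: eq_bigr => x _; rewrite mulr_sumr.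
- by exists a => z tz; rewrite fg // Ha.
Qed.

(** The torus is open, so derivatives at its points only depend on values on
    the torus. *)
Lemma torus_near (z : 'cV[K]_d) : torus z -> \forall y \near z, torus y.
Proof.
move=> tz.
apply: (@filter_forall _ _ (fun i (y : 'cV[K]_d) => y i 0 != 0) (nbhs z) _ _).
move=> i.
exact: cvgr_neq0 (@coord_continuous K _ _ i 0 z) (tz i).
Qed.

Lemma partialE i f : partial i f = fun z => 'D_(delta_mx i 0) f z.
Proof. by rewrite unlock. Qed.

Lemma partial_eq i f g z : (forall z, torus z -> f z = g z) -> torus z ->
  partial i f z = partial i g z.
Proof.
move=> fg tz; rewrite !partialE; apply: near_eq_derive.
by apply: filterS (torus_near tz) => y; apply: fg.
Qed.

Lemma laurent_derivable f i z : laurent_fun f -> torus z ->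
  derivable f z (delta_mx i 0).
Proof.
move=> lf tz; elim: lf => {f} [c|j|j|f g _ df _ dg|f g _ df _ dg|f g _ df fg].
- exact: derivable_cst.
- exact/diff_derivable/differentiable_coord.
- apply: derivableV; first exact: tz.
  exact/diff_derivable/differentiable_coord.
- exact: derivableD.
- exact: derivableM.
- apply: near_eq_derivable df.
  by apply: filterS (torus_near tz) => y ty; rewrite fg.
Qed.

Lemma partialC i (c : R[i]) z : partial i (fun=> c) z = 0.
Proof. by rewrite partialE; exact: derive_cst. Qed.

Lemma partialX i j z : partial i (fun z => z j 0) z = (i == j)%:R.
Proof.
pose h (z : 'cV[K]_d) : K := z j 0.
have lh : linear h by move=> c u v; rewrite /h !mxE.
pose H := GRing.isLinear.Build _ _ _ _ h lh.
pose L : {linear 'cV[K]_d -> K} := HB.pack h H.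
rewrite partialE (_ : (fun z => _) = L) //.
rewrite deriveE; last exact/linear_differentiable/coord_continuous.
rewrite diff_lin; last exact/coord_continuous.
by rewrite /= /h mxE eqxx andbT eq_sym.
Qed.

Lemma partialV i j z : torus z ->
  partial i (fun z => (z j 0)^-1) z = - (i == j)%:R * (z j 0)^-1 * (z j 0)^-1.
Proof.
move=> tz; rewrite partialE deriveV //; last first.
  exact/diff_derivable/differentiable_coord.
have := partialX i j z; rewrite partialE => ->.
by rewrite /GRing.scale /= -exprVn; ring.
Qed.

Lemma partialD i f g z : laurent_fun f -> laurent_fun g -> torus z ->
  partial i (fun z => f z + g z) z = partial i f z + partial i g z.
Proof.
move=> lf lg tz; rewrite !partialE.
by apply: deriveD; apply: laurent_derivable.
Qed.

Lemma partialM i f g z : laurent_fun f -> laurent_fun g -> torus z ->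
  partial i (fun z => f z * g z) z = partial i f z * g z + f z * partial i g z.
Proof.
move=> lf lg tz; rewrite !partialE [X in X + _]mulrC addrC.
by apply: deriveM; apply: laurent_derivable.
Qed.

Lemma laurent_partial i f : laurent_fun f -> laurent_fun (partial i f).
Proof.
elim=> {f} [c|j|j|f g lf lf' lg lg'|f g lf lf' lg lg'|f g lf lf' fg].
- by apply: laurent_ext laurent0 _ => z _; rewrite partialC.
- apply: laurent_ext (laurentC (i == j)%:R) _ => z _.
  by rewrite partialX rmorph_nat.
- apply: laurent_ext (laurentM (laurentM (laurentN (laurentC (i == j)%:R))
    (laurentV j)) (laurentV j)) _ => z tz.
  by rewrite partialV // rmorph_nat.
- by apply: laurent_ext (laurentD lf' lg') _ => z tz; rewrite partialD.
- apply: laurent_ext (laurentD (laurentM lf' lg) (laurentM lf lg')) _ => z tz.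
  by rewrite partialM.
- by apply: laurent_ext lf' _ => z; apply: partial_eq.
Qed.

Lemma partial_comm i j f z : laurent_fun f -> torus z ->
  partial i (partial j f) z = partial j (partial i f) z.
Proof.
move=> lf; elim: lf z => {f}
  [c|l|l|f g lf IHf lg IHg|f g lf IHf lg IHg|f g lf IHf fg] z tz.
- rewrite !(@partial_eq _ (partial _ _) (fun=> 0)) ?partialC // => y _;
  exact: partialC.
- rewrite (@partial_eq _ (partial _ _) (fun=> (j == l)%:R)) ?partialC //.
    rewrite (@partial_eq _ (partial _ _) (fun=> (i == l)%:R)) ?partialC //.
    by move=> y _; apply: partialX.
  by move=> y _; apply: partialX.
- have E (m n : 'I_d) : partial m (partial n (fun z => (z l 0)^-1)) z =
      2 * (m == l)%:R * (n == l)%:R * (z l 0)^-1 ^+ 3.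
    pose c : K := (- (n == l)%:R : R)%:C.
    have lV := laurentV l; have lVV := laurentM lV lV.
    rewrite (@partial_eq _ _ (fun z => c * ((z l 0)^-1 * (z l 0)^-1))) //.
      have lc := laurentC (- (n == l)%:R).
      rewrite (partialM _ lc lVV) // (partialM _ lV lV) // partialC !partialV //.
      by rewrite /c rmorphN rmorph_nat; ring.
    by move=> y ty; rewrite partialV // /c rmorphN rmorph_nat mulrA.
  by rewrite !E; ring.
- have H m n : partial m (partial n (fun z => f z + g z)) z =
      partial m (partial n f) z + partial m (partial n g) z.
    apply: etrans (partial_eq m (fun y => @partialD n f g y lf lg) tz) _.
    exact: partialD (laurent_partial n lf) (laurent_partial n lg) tz.
  by rewrite (H i j) (H j i) (IHf z tz) (IHg z tz).
- have H m n : partial m (partial n (fun z => f z * g z)) z =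
      partial m (partial n f) z * g z + partial n f z * partial m g z
      + (partial m f z * partial n g z + f z * partial m (partial n g) z).
    have lf' := laurent_partial n lf; have lg' := laurent_partial n lg.
    apply: etrans (partial_eq m (fun y => @partialM n f g y lf lg) tz) _.
    rewrite (partialD m (laurentM lf' lg) (laurentM lf lg')) //.
    by rewrite (partialM m lf' lg) // (partialM m lf lg').
  by rewrite (H i j) (H j i) (IHf z tz) (IHg z tz); ring.
- have H m n : partial m (partial n g) z = partial m (partial n f) z.
    by apply: partial_eq tz => y ty; apply: partial_eq.
  by rewrite (H i j) (H j i) IHf.
Qed.

(** The shape of [mixed_partial], over an arbitrary list of coordinates so that
    induction is possible. *)
Definition partials (j : 'I_d -> nat) f (s : seq 'I_d) :=
  foldr (fun i g => iter (j i) (partial i) g) f s.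

Lemma partials_laurent j f s : laurent_fun f -> laurent_fun (partials j f s).
Proof.
move=> lf; elim: s => //= i s IH; elim: (j i) => //= n IHn.
exact: laurent_partial.
Qed.

Lemma iter_partial_eq i n f g z : (forall z, torus z -> f z = g z) -> torus z ->
  iter n (partial i) f z = iter n (partial i) g z.
Proof.
move=> fg; elim: n z => [|n IH] z tz /=; first exact: fg.
exact: partial_eq.
Qed.

Lemma iter_partial_comm i i' n f z : laurent_fun f -> torus z ->
  iter n (partial i') (partial i f) z = partial i (iter n (partial i') f) z.
Proof.
move=> lf; elim: n z => [|n IH] z tz //=.
rewrite (partial_eq i' IH) // partial_comm //.
by elim: n {IH} => //= n IH; apply: laurent_partial.
Qed.

Lemma partials_comm i j f s z : laurent_fun f -> torus z ->
  partials j (partial i f) s z = partial i (partials j f s) z.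
Proof.
move=> lf; elim: s z => [|i' s IH] z tz //=.
rewrite (iter_partial_eq _ _ IH) // iter_partial_comm //.
exact: partials_laurent.
Qed.

Lemma partials_eqn j j' f s : {in s, j =1 j'} ->
  partials j f s = partials j' f s.
Proof.
elim: s => //= i s IH jj'; rewrite jj' ?mem_head // IH // => x xs.
by rewrite jj' // inE xs orbT.
Qed.

(** Since the derivatives commute, one more derivative in direction [i] may be
    moved next to those already taken in this direction. *)
Lemma partials_succ i j f s z : laurent_fun f -> uniq s -> i \in s -> torus z ->
  partials j (partial i f) s z =
  partials (fun x => (j x + (x == i))%N) f s z.
Proof.
move=> lf; elim: s z => [|i' s IH] //= z /andP[i's us]; rewrite inE.
case: (eqVneq i i') i's => [<-|ii'] i's /= is_ tz.
  rewrite addn1 iterSr; apply: iter_partial_eq => // y ty.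
  rewrite partials_comm //; congr (partial i _ y); apply: partials_eqn.
  by move=> x xs; case: eqVneq xs i's => [->->|]; rewrite ?addn0.
by rewrite addn0; apply: iter_partial_eq => // y ty; apply: IH.
Qed.

End LaurentFunctions.

(** * Powers of ideals of Laurent polynomial functions *)

Section IdealPowers.
Variables (R : realType) (d : nat).
Notation K := (R[i] : numFieldType).
Implicit Types (f g h : 'cV[K]_d -> K) (z : 'cV[K]_d).
Implicit Types (G : ('cV[K]_d -> K) -> Prop).

(** The [k]-th power of the ideal generated by [G]. Only values on the torus are
    significant; a constructor for zero is needed when [G] is empty. *)
Inductive ideal_power G : nat -> ('cV[K]_d -> K) -> Prop :=
| ideal_power0 f : laurent_fun f -> ideal_power G 0 f
| ideal_power_zero k : ideal_power G k (fun=> 0)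
| ideal_powerS k g f : G g -> ideal_power G k f ->
    ideal_power G k.+1 (fun z => g z * f z)
| ideal_powerD k f1 f2 : ideal_power G k f1 -> ideal_power G k f2 ->
    ideal_power G k (fun z => f1 z + f2 z)
| ideal_power_ext k f1 f2 : ideal_power G k f1 ->
    (forall z, torus z -> f2 z = f1 z) -> ideal_power G k f2.

Section Generators.
Variable G : ('cV[K]_d -> K) -> Prop.
Hypothesis G_laurent : forall g, G g -> laurent_fun g.

Lemma ideal_power_laurent k f : ideal_power G k f -> laurent_fun f.
Proof.
elim=> {k f} [//|k|k g f Gg _ lf|k f1 f2 _ l1 _ l2|k f1 f2 _ l1 e].
- exact: laurent0.
- exact: laurentM (G_laurent Gg) lf.
- exact: laurentD.
- exact: laurent_ext e.
Qed.

Lemma ideal_powerMl k h f : laurent_fun h -> ideal_power G k f ->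
  ideal_power G k (fun z => h z * f z).
Proof.
move=> lh; elim=> {k f} [f lf|k|k g f Gg _ IH|k f1 f2 _ IH1 _ IH2|k f1 f2 _ IH e].
- exact/ideal_power0/laurentM.
- by apply: ideal_power_ext (ideal_power_zero _ _) _ => z _; rewrite mulr0.
- apply: ideal_power_ext (ideal_powerS Gg IH) _ => z _; exact: mulrCA.
- by apply: ideal_power_ext (ideal_powerD IH1 IH2) _ => z _; rewrite mulrDr.
- by apply: ideal_power_ext IH _ => z tz; rewrite e.
Qed.

Lemma ideal_powerM k l f g : ideal_power G k f -> ideal_power G l g ->
  ideal_power G (k + l) (fun z => f z * g z).
Proof.
move=> If Ig; elim: If => {k f}
  [f lf|k|k h f Gh _ IH|k f1 f2 _ IH1 _ IH2|k f1 f2 _ IH e].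
- exact: ideal_powerMl.
- by apply: ideal_power_ext (ideal_power_zero _ _) _ => z _; rewrite mul0r.
- by apply: ideal_power_ext (ideal_powerS Gh IH) _ => z _; rewrite mulrA.
- by apply: ideal_power_ext (ideal_powerD IH1 IH2) _ => z _; rewrite mulrDl.
- by apply: ideal_power_ext IH _ => z tz; rewrite e.
Qed.

Lemma ideal_power_gen g : G g -> ideal_power G 1 g.
Proof.
move=> Gg.
apply: ideal_power_ext (ideal_powerS Gg (ideal_power0 _ (@laurent1 R d))) _.
by move=> z _; rewrite mulr1.
Qed.

Lemma ideal_power_sum k (I : Type) (s : seq I) (F : I -> 'cV[K]_d -> K) :
  (forall x, ideal_power G k (F x)) ->
  ideal_power G k (fun z => \sum_(x <- s) F x z).
Proof.
move=> IF; elim: s => [|x s IH].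
  by apply: ideal_power_ext (ideal_power_zero _ _) _ => z _; rewrite big_nil.
by apply: ideal_power_ext (ideal_powerD (IF x) IH) _ => z _; rewrite big_cons.
Qed.

Lemma ideal_powerX k f : ideal_power G 1 f -> ideal_power G k (fun z => f z ^+ k).
Proof.
move=> If; elim: k => [|k IH].
  by apply: ideal_power_ext (ideal_power0 _ (@laurent1 R d)) _ => z _.
by apply: ideal_power_ext (ideal_powerM If IH) _ => z _; rewrite exprS.
Qed.

Lemma ideal_power_prod k (F : 'I_k -> 'cV[K]_d -> K) :
  (forall x, ideal_power G 1 (F x)) ->
  ideal_power G k (fun z => \prod_(x < k) F x z).
Proof.
elim: k F => [|k IH] F IF.
  apply: ideal_power_ext (ideal_power0 _ (@laurent1 R d)) _ => z _.
  by rewrite big_ord0.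
have := ideal_powerM (IF ord0) (IH _ (fun x => IF (lift ord0 x))).
by move/ideal_power_ext; apply=> z _; rewrite big_ord_recl.
Qed.

End Generators.

(** Serves to trade the linear factors at a sign point for box polynomials, at
    the cost of a multiplier [h] for each factor. *)
Lemma ideal_power_subst G1 G2 k f h :
  laurent_fun h ->
  (forall g, G1 g -> ideal_power G2 1 (fun z => g z * h z)) ->
  ideal_power G1 k f -> ideal_power G2 k (fun z => f z * h z ^+ k).
Proof.
move=> lh G12; elim=> {k f}
  [f lf|k|k g f Gg _ IH|k f1 f2 _ IH1 _ IH2|k f1 f2 _ IH e].
- by apply/ideal_power0/laurentM => //; apply: laurent_exp.
- by apply: ideal_power_ext (ideal_power_zero _ _) _ => z _; rewrite mul0r.
- have := ideal_powerM (G12 _ Gg) IH.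
  by move/ideal_power_ext; apply=> z _; rewrite exprS; ring.
- by apply: ideal_power_ext (ideal_powerD IH1 IH2) _ => z _; rewrite mulrDl.
- by apply: ideal_power_ext IH _ => z tz; rewrite e.
Qed.

End IdealPowers.

(** * Order of vanishing at a sign point *)

Section Vanishing.
Variables (R : realType) (d : nat).
Notation K := (R[i] : numFieldType).
Implicit Types (f g h : 'cV[K]_d -> K) (z : 'cV[K]_d) (b : {ffun 'I_d -> bool}).

Definition sign_point b : 'cV[K]_d := \col_i (-1) ^+ b i.

Definition linear_factor b g :=
  exists i, g = fun z : 'cV[K]_d => z i 0 - (-1) ^+ b i.

Lemma laurent_sign n : laurent_fun (fun _ : 'cV[K]_d => (-1) ^+ n).
Proof.
by apply: laurent_ext (laurentC _ ((-1) ^+ n)) _ => z _; rewrite rmorphXn rmorphN1.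
Qed.

Lemma linear_factor_laurent b g : linear_factor b g -> laurent_fun g.
Proof.
by move=> [i ->]; apply: laurentB; [exact: laurentX | exact: laurent_sign].
Qed.
Hint Resolve linear_factor_laurent : core.

Lemma sign_point_torus b : torus (sign_point b).
Proof. by move=> i; rewrite mxE signr_eq0. Qed.
Hint Resolve sign_point_torus : core.

Notation Mp b := (ideal_power (linear_factor b)).


(** The residue field at a sign point is the field of real numbers, because the
    coordinates of the point are real: modulo the linear factors every [z_i] and
    every [z_i^-1] is the sign [(-1) ^ b_i]. *)
Lemma point_ideal_const b f : laurent_fun f ->
  exists r : R, f (sign_point b) = r%:C /\ Mp b 1 (fun z => f z - r%:C).
Proof.
have Mx i : Mp b 1 (fun z => z i 0 - (-1) ^+ b i).
  by apply: ideal_power_gen; exists i.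
elim=> {f} [c|i|i|f g lf [r [fr Ir]] lg [s [gs Is]]|
  f g lf [r [fr Ir]] lg [s [gs Is]]|f g lf [r [fr Ir]] fg].
- exists c; split => //.
  by apply: ideal_power_ext (ideal_power_zero _ _) _ => z _; rewrite subrr.
- exists ((-1) ^+ b i); rewrite rmorphXn rmorphN1 mxE; split => //.
- exists ((-1) ^+ b i); rewrite rmorphXn rmorphN1 mxE invr_sign; split => //.
  have /(ideal_powerMl (laurentM (laurent_sign (b i).+1) (laurentV _ i))) := Mx i.
  move/ideal_power_ext; apply=> z tz.
  rewrite exprS mulN1r mulrBr -!mulrA mulVf // mulr1 !mulNr opprK addrC.
  by rewrite [_^-1 * _]mulrC signrMK.
- exists (r + s); rewrite rmorphD fr gs; split => //.
  by apply: ideal_power_ext (ideal_powerD Ir Is) _ => z _; rewrite opprD addrACA.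
- exists (r * s); rewrite rmorphM fr gs; split => //.
  have := ideal_powerD (ideal_powerMl lf Is) (ideal_powerMl (laurentC _ s) Ir).
  by move/ideal_power_ext; apply=> z _; ring.
- exists r; split; first by rewrite fg.
  by apply: ideal_power_ext Ir _ => z tz; rewrite fg.
Qed.

Lemma point_ideal1 b f : laurent_fun f ->
  f (sign_point b) = 0 -> Mp b 1 f.
Proof.
move=> lf f0; have [r [fr Ir]] := point_ideal_const b lf.
by apply: ideal_power_ext Ir _ => z _; rewrite -fr f0 subr0.
Qed.

Lemma point_ideal_vanish b k f : Mp b k.+1 f -> f (sign_point b) = 0.
Proof.
move E: k.+1 => k' If; elim: If k E => {k' f}
  [//|//|k' g f [i ->] _ _ k _|k' f1 f2 _ IH1 _ IH2 k E|k' f1 f2 _ IH e k E].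
- by rewrite mxE subrr mul0r.
- by rewrite (IH1 _ E) (IH2 _ E) addr0.
- by rewrite e // (IH _ E).
Qed.

(** By the Leibniz rule, differentiating a product of [k] linear factors spares at
    least [k - 1] of them. *)
Lemma partial_point_ideal b k i f : Mp b k f -> Mp b k.-1 (partial i f).
Proof.
elim=> {k f} [f lf|k|k g f Gg If IH|k f1 f2 I1 IH1 I2 IH2|k f1 f2 I1 IH1 e] /=.
- exact/ideal_power0/laurent_partial.
- by apply: ideal_power_ext (ideal_power_zero _ _) _ => z _; rewrite partialC.
- have lf := ideal_power_laurent (@linear_factor_laurent b) If.
  have lg := linear_factor_laurent Gg.
  have H1 := ideal_powerMl (laurent_partial i lg) If.
  have H2 : Mp b k (fun z => g z * partial i f z).
    case: k If IH {H1} => [|k] If IH.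
      exact/ideal_power0/laurentM/laurent_partial.
    exact: ideal_powerS.
  apply: ideal_power_ext (ideal_powerD H1 H2) _ => z tz.
  by rewrite (partialM i lg lf tz).
- have l1 := ideal_power_laurent (@linear_factor_laurent b) I1.
  have l2 := ideal_power_laurent (@linear_factor_laurent b) I2.
  apply: ideal_power_ext (ideal_powerD IH1 IH2) _ => z tz.
  exact: partialD l1 l2 tz.
- by apply: ideal_power_ext IH1 _ => z tz; apply: partial_eq.
Qed.

(** Euler's identity: [sum_i (z_i - eps_i) D_i] is a derivation that fixes the
    linear factors, hence multiplies a product of [k] of them by [k], and
    differentiating the cofactors only contributes terms of order [k + 1]. *)
Lemma euler_point_ideal b k f : Mp b k f ->
  Mp b k.+1 (fun z =>
    \sum_(i < d) (z i 0 - (-1) ^+ b i) * partial i f z - k%:R * f z).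
Proof.
have lG := @linear_factor_laurent b.
elim=> {k f} [f lf|k|k g f Gg If IH|k f1 f2 I1 IH1 I2 IH2|k f1 f2 I1 IH1 e].
- have H : Mp b 1
      (fun z => \sum_(i < d) (z i 0 - (-1) ^+ b i) * partial i f z).
    apply: ideal_power_sum => i.
    apply: (ideal_powerS (ex_intro _ i erefl : linear_factor b _)).
    exact/ideal_power0/laurent_partial.
  by apply: ideal_power_ext H _ => z _; rewrite mul0r subr0.
- apply: ideal_power_ext (ideal_power_zero _ _) _ => z _.
  by rewrite mulr0 subr0 big1 // => i _; rewrite partialC mulr0.
- have lf := ideal_power_laurent lG If.
  have lg := lG _ Gg.
  have Eg z : torus z ->
      \sum_(i < d) (z i 0 - (-1) ^+ b i) * partial i g z = g z.
    case: Gg => j -> tz.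
    have dg i : partial i (fun z : 'cV[K]_d => z j 0 - (-1) ^+ b j) z
        = (i == j)%:R.
      rewrite (partialD i (laurentX _ j) (laurentN (laurent_sign (b j))) tz).
      by rewrite partialX partialC addr0.
    rewrite (bigD1 j) //= big1 => [|i /negPf ij]; last by rewrite dg ij mulr0.
    by rewrite dg eqxx mulr1 addr0.
  apply: ideal_power_ext (ideal_powerS Gg IH) _ => z tz.
  have -> : \sum_(i < d) (z i 0 - (-1) ^+ b i) * partial i (fun z => g z * f z) z
      = g z * f z + g z * \sum_(i < d) (z i 0 - (-1) ^+ b i) * partial i f z.
    rewrite -[X in X * f z + _](Eg z tz) mulr_suml mulr_sumr -big_split /=.
    by apply: eq_bigr => i _; rewrite (partialM i lg lf tz); ring.
  by rewrite -natr1; ring.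
- have l1 := ideal_power_laurent lG I1.
  have l2 := ideal_power_laurent lG I2.
  apply: ideal_power_ext (ideal_powerD IH1 IH2) _ => z tz.
  rewrite mulrDr opprD addrACA -big_split /=; congr (_ + _).
  by apply: eq_bigr => i _; rewrite (partialD i l1 l2 tz) mulrDr.
- have l1 := ideal_power_laurent lG I1.
  apply: ideal_power_ext IH1 _ => z tz; rewrite (e z tz); congr (_ - _).
  by apply: eq_bigr => i _; rewrite (partial_eq i e tz).
Qed.

Lemma mixed_partialE (j : 'I_d -> nat) f :
  mixed_partial j f = partials j f (enum 'I_d).
Proof.
congr (foldr _ _ _); apply/funext => i; apply/funext => g.
by congr (iter _ _ _); apply/funext => h; rewrite partialE.
Qed.

Lemma partials_point_ideal b k j f s : Mp b (\sum_(i <- s) j i + k) f ->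
  Mp b k (partials j f s).
Proof.
elim: s k => [|i s IH] k; first by rewrite big_nil.
rewrite big_cons -addnA addnCA => /IH /=.
elim: (j i) k => [|n IHn] k //=.
by rewrite addSnnS => /IHn /(partial_point_ideal i).
Qed.

(** For the backward direction, induction on [k]: if [f] vanishes to order
    [k + 1], then [f] and all its first derivatives lie in the [k]-th power, and
    Euler's identity expresses [k f] through the products
    [(z_i - eps_i) D_i f], up to the next power. *)
Lemma point_ideal_mixed_partial b k f : laurent_fun f ->
  Mp b k f <-> forall j : 'I_d -> nat, (\sum_(i < d) j i < k)%N ->
    mixed_partial j f (sign_point b) = 0.
Proof.
move=> lf; split=> [If j jk|].
  rewrite mixed_partialE.
  apply: (@point_ideal_vanish _ (k - \sum_(i < d) j i).-1).
  apply: partials_point_ideal; rewrite big_enum /= prednK ?subn_gt0 //.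
  by rewrite subnKC // ltnW.
case: k => [|k]; first by move=> _; apply: ideal_power0.
elim: k f lf => [|k IH] f lf Vf.
  apply: point_ideal1 => //; have := Vf (fun=> 0%N).
  by rewrite big1 // => /(_ isT) <-; rewrite mixed_partialE; elim: (enum _).
have If : Mp b k.+1 f by apply: IH => // j jk; apply/Vf/ltnW.
have Id i : Mp b k.+1 (partial i f).
  apply: IH => [|j jk]; first exact: laurent_partial.
  rewrite mixed_partialE partials_succ ?enum_uniq ?mem_enum //.
  rewrite -mixed_partialE; apply: Vf; rewrite big_split /=.
  have -> : (\sum_(x < d) (x == i) = 1)%N.
    by rewrite (bigD1 i) //= eqxx big1 // => x /negPf ->.
  by rewrite addn1.
have lG := @linear_factor_laurent b.
have IS : Mp b k.+2 (fun z => \sum_(i < d) (z i 0 - (-1) ^+ b i) * partial i f z).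
  apply: ideal_power_sum => i.
  exact: ideal_powerS (ex_intro _ i erefl : linear_factor b _) (Id i).
have := ideal_powerD (ideal_powerMl (laurentC _ k.+1%:R^-1) IS)
  (ideal_powerMl (laurentC _ (- k.+1%:R^-1)) (euler_point_ideal If)).
move/ideal_power_ext; apply=> z _; rewrite rmorphN /= fmorphV rmorph_nat.
by rewrite mulNr mulrBr; rewrite mulKf ?pnatr_eq0 //; ring.
Qed.

End Vanishing.

(** * Unimodular submatrices *)

Section UnimodularSubmatrices.
Variable d : nat.
Implicit Types (Theta : 'M[int]_d) (s l : 'I_d) (A : {ffun 'I_d -> bool}).

Lemma unimodular_unitmx Theta : unimodular Theta -> Theta \in unitmx.
Proof. by rewrite unitmxE => -[] ->; rewrite ?unitrN unitr1. Qed.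

Lemma unitmx_unimodular Theta : Theta \in unitmx -> unimodular Theta.
Proof.
rewrite unitmxE /unimodular => /orP[] /eqP ->; [by left|by right].
Qed.

(** Invertibility makes the columns nonzero and pairwise distinct. *)
Lemma binary_unitmx_submatrix (B : 'I_d -> 'I_d -> bool) Theta :
  (forall i l, Theta i l = (B i l : nat)%:Z) -> Theta \in unitmx ->
  submatrix_of_X Theta.
Proof.
move=> TB uT.
have col_inj (u v : 'cV[int]_d) : Theta *m u = Theta *m v -> u = v.
  by move=> /(congr1 (mulmx (invmx Theta))); rewrite !mulKmx.
pose v l : 'cV[bool]_d := \col_i B i l.
have v_nz l : v l \in nonzero_binary d.
  rewrite inE; apply/eqP => vl0.
  have /col_inj/matrixP/(_ l 0) : Theta *m delta_mx l (0 : 'I_1) = Theta *m 0.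
    rewrite -colE mulmx0; apply/matrixP => i j; rewrite !mxE TB.
    by have /matrixP/(_ i 0) := vl0; rewrite !mxE => ->.
  by rewrite !mxE !eqxx.
have sK l : enum_val (enum_rank_in (v_nz l) (v l)) = v l.
  exact: enum_rankK_in.
exists (fun l => enum_rank_in (v_nz l) (v l)); last first.
  by apply/matrixP => i l; rewrite !mxE sK mxE TB.
move=> l l' /(congr1 enum_val); rewrite !sK => vll'.
have /col_inj/matrixP/(_ l 0) :
    Theta *m delta_mx l (0 : 'I_1) = Theta *m delta_mx l' 0.
  rewrite -!colE; apply/matrixP => i j; rewrite !mxE !TB.
  by have /matrixP/(_ i 0) := vll'; rewrite !mxE => ->.
by rewrite !mxE !eqxx andbT; case: eqP.
Qed.

(** The matrix [1 + e_s a^T + c e_s^T], where [a] and [c] are the indicators of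
    [A] and [t], as soon as neither of these contains [s]. *)
Definition shear s A (t : option 'I_d) : 'M[int]_d :=
  \matrix_(i, l) ([|| i == l, (i == s) && A l | (l == s) && (t == Some i)]
                  : nat)%:Z.

Lemma nilpotent_unitmx (x : 'M[int]_d) : x *m x = 0 -> 1%:M + x \in unitmx.
Proof.
move=> xx; have /mulmx1_unit [] // : (1%:M + x) *m (1%:M - x) = 1%:M.
by rewrite mulmxDl mul1mx mulmxBr mulmx1 xx subr0 subrK.
Qed.

(** The matrix factors as [(1 + e_s a^T) (1 + c e_s^T)], because the cross term
    [(a . c) e_s e_s^T] is zero when [A] and [t] are disjoint. *)
Lemma shear_unitmx s A t : ~~ A s -> (forall i, t = Some i -> i != s /\ ~~ A i) ->
  shear s A t \in unitmx.
Proof.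
move=> As At.
pose x : 'M[int]_d := \matrix_(i, l) (((i == s) && A l) : nat)%:Z.
pose y : 'M[int]_d := \matrix_(i, l) (((l == s) && (t == Some i)) : nat)%:Z.
have xy : x *m y = 0.
  apply/matrixP => i l; rewrite !mxE big1 // => j _; rewrite !mxE.
  by case: (eqVneq t (Some j)) => [/At[_ /negPf->]|]; rewrite ?andbF ?mulr0 ?mul0r.
have xx : x *m x = 0.
  apply/matrixP => i l; rewrite !mxE big1 // => j _; rewrite !mxE.
  by case: (eqVneq j s) => [->|]; rewrite ?(negPf As) ?andbF ?mul0r ?mulr0.
have yy : y *m y = 0.
  apply/matrixP => i l; rewrite !mxE big1 // => j _; rewrite !mxE.
  by case: (eqVneq t (Some j)) => [/At[/negPf-> _]|]; rewrite ?andbF ?mulr0 ?mul0r.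
suff -> : shear s A t = (1%:M + x) *m (1%:M + y).
  by rewrite unitmx_mul !nilpotent_unitmx.
rewrite mulmxDl mul1mx mulmxDr mulmx1 xy addr0 -addrA [y + x]addrC addrA.
apply/matrixP => i l; rewrite !mxE.
case: (eqVneq i l) => [<-|il] /=.
  case: (eqVneq i s) => [->|] /=; last by rewrite addr0.
  by rewrite (negPf As); case: eqP => [/At[]|]; rewrite ?eqxx.
case: (eqVneq l s) il => [->|] il; last by rewrite addr0 orbF add0r.
by rewrite (negPf As) andbF add0r.
Qed.

Definition admissible Theta := submatrix_of_X Theta /\ unimodular Theta.

Lemma shear_admissible s A t :
  ~~ A s -> (forall i, t = Some i -> i != s /\ ~~ A i) ->
  admissible (shear s A t).
Proof.
move=> As At; have uS := shear_unitmx As At; split.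
  apply: binary_unitmx_submatrix uS => i l; rewrite mxE; reflexivity.
exact: unitmx_unimodular.
Qed.

End UnimodularSubmatrices.

(** * The ideal generated by the box polynomials *)

Section BoxIdeal.
Variables (R : realType) (d : nat).
Notation K := (R[i] : numFieldType).
Implicit Types (f g h : 'cV[K]_d -> K) (z : 'cV[K]_d).
Implicit Types (A b : {ffun 'I_d -> bool}) (s t : 'I_d).

Definition box_factor g := exists2 Theta, admissible Theta & g = qpoly Theta.

Notation Gq := (ideal_power box_factor).

Lemma box_factor_laurent g : box_factor g -> laurent_fun g.
Proof.
case=> Theta _ ->; apply: laurent_prod => l _.
have l2 := laurent_half R d.
apply: laurentM l2; apply: laurentD; first exact: laurent1.
exact: laurent_monomial.
Qed.

Lemma qpoly_shear s A (t : option 'I_d) z : torus z -> ~~ A s ->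
  (forall i, t = Some i -> i != s) ->
  qpoly (shear s A t) z =
    (1 + z s 0 * (if t is Some i then z i 0 else 1)) / 2 *
    \prod_(l | l != s) ((1 + z l 0 * (if A l then z s 0 else 1)) / 2).
Proof.
move=> tz As ts; rewrite /qpoly (bigD1 s) //=; congr (_ * _).
  congr ((1 + _) / 2).
  have -> : col s (shear s A t) =
      1 *: delta_mx s 0 + (if t is Some i then 1 *: delta_mx i 0 else 0).
    apply/matrixP => i j; rewrite !mxE eqxx (negPf As) andbF mul1r ord1 andbT.
    case: t ts => [i'|] ts; rewrite ?mxE /= ?orbF ?addr0 //; last by case: (i == s).
    rewrite mul1r andbT (inj_eq Some_inj) [i' == i]eq_sym.
    case: (eqVneq i i') => [->|]; last by case: (i == s).
    by rewrite (negPf (ts _ erefl)).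
  rewrite monomialD // monomial_delta expr1z.
  case: (t) => [i|]; first by rewrite monomial_delta expr1z.
  by rewrite /monomial big1 // => i _; rewrite mxE.
apply: eq_bigr => l ls; congr ((1 + _) / 2).
have -> : col l (shear s A t) = 1 *: delta_mx l 0 + (A l : nat)%:Z *: delta_mx s 0.
  apply/matrixP => i j; rewrite !mxE (negPf ls) orbF mul1r ord1 !andbT.
  case: (eqVneq i l) => [->|] /=; first by rewrite (negPf ls) mulr0.
  by case: (i == s); rewrite ?mulr0 ?mulr1.
by rewrite monomialD // !monomial_delta expr1z; case: (A l).
Qed.

Definition half_factor b (i : 'I_d) z : K := (1 + (-1) ^+ b i * z i 0) / 2.

Definition bump_at b z : K := \prod_i half_factor b i z.

Lemma laurent_half_factor b i : laurent_fun (half_factor b i).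
Proof.
have l2 := laurent_half R d.
apply: laurentM l2; apply: laurentD; first exact: laurent1.
exact: laurentM (laurent_sign _ _ _) (laurentX _ _).
Qed.

Lemma laurent_bump_at b : laurent_fun (bump_at b).
Proof. by apply: laurent_prod => i _; apply: laurent_half_factor. Qed.

(** Write [w_j] for [half_factor b j] and [E] for [bump_at b], a multiple of
    [w_s]. If [b j], then
      [w_s w_j = (1 + z_j z_s) / 2 - (1 + z_s) / 2 * ((1 + z_j) / 2)],
    and otherwise [w_j] is [(1 + z_j) / 2]. So each [w_j E] is a combination of
    the two factors that column [j] of a shear matrix can contribute, the one
    with [z_j z_s] occurring only when [b j]. Distributing the product gives a
    combination of polynomials of shear matrices with [A] contained in [b]. *)
Lemma box_ideal_core b s (t : option 'I_d) : b s ->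
  (forall i, t = Some i -> ~~ b i) ->
  Gq 1 (fun z => (1 + z s 0 * (if t is Some i then z i 0 else 1)) / 2 *
     \prod_(j | j != s) (half_factor b j z * bump_at b z)).
Proof.
move=> bs bt.
pose x z : K := (1 + z s 0 * (if t is Some i then z i 0 else 1)) / 2.
pose rest z := \prod_(i | i != s) half_factor b i z.
pose beta (l : 'I_d) (c : bool) z : K :=
  (1 + z l 0 * (if c then z s 0 else 1)) / 2.
pose coef (l : 'I_d) (c : bool) z : K :=
  if c then (if b l then rest z else 0)
  else (if b l then - ((1 + z s 0) / 2) * rest z
        else half_factor b s z * rest z).
(* Giving index [s] the terms 0 and [x] turns the product into one over all
   indices and discards the functions [A] with [A s]. *)
pose F (l : 'I_d) (c : bool) z : K :=
  if l == s then (if c then 0 else x z) else coef l c z * beta l c z.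
have l2 := laurent_half R d.
have lrest : laurent_fun rest.
  by apply: laurent_prod => i _; apply: laurent_half_factor.
have lcoef l c : laurent_fun (coef l c).
  rewrite /coef; case: c; case: (b l) => //; first exact: laurent0.
    apply: laurentM lrest; apply/laurentN/laurentM => //.
    exact: laurentD (laurent1 _ _) (laurentX _ _).
  exact: laurentM (laurent_half_factor _ _) lrest.
have sumF z : (1 + z s 0 * (if t is Some i then z i 0 else 1)) / 2 *
     \prod_(j | j != s) (half_factor b j z * bump_at b z)
     = \sum_(A : {ffun 'I_d -> bool}) \prod_l F l (A l) z.
  rewrite -(bigA_distr_bigA (fun l c => F l c z)) [RHS](bigD1 s) //=.
  congr (_ * _).
    by rewrite big_bool /F eqxx /= add0r.
  apply: eq_bigr => l ls; rewrite big_bool /F (negPf ls).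
  rewrite /bump_at (bigD1 s) //= -/(rest z) /coef /beta /half_factor bs.
  by case: (b l); rewrite ?expr0 ?expr1; field.
apply: ideal_power_ext (fun z _ => sumF z).
apply: ideal_power_sum => A.
case As: (A s).
  apply: ideal_power_ext (ideal_power_zero _ _) _ => z _.
  by rewrite (bigD1 s) //= /F eqxx As mul0r.
have [Ab|] := boolP [forall l, A l ==> b l]; last first.
  rewrite negb_forall => /existsP[l]; rewrite negb_imply => /andP[Al bl].
  apply: ideal_power_ext (ideal_power_zero _ _) _ => z _.
  have ls : l != s by apply: contraNneq bl => ->.
  by rewrite (bigD1 l) //= /F (negPf ls) /coef Al (negPf bl) !mul0r.
have ts i : t = Some i -> i != s by move=> /bt; apply: contraNneq => ->.
have qA : box_factor (@qpoly R d (shear s A t)).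
  exists (shear s A t) => //; apply: shear_admissible; first by rewrite As.
  move=> i ti; split; first exact: ts.
  by apply: contra (bt _ ti) => Ai; apply: (implyP (forallP Ab i)).
have lprod : laurent_fun (fun z => \prod_(l | l != s) coef l (A l) z).
  by apply: laurent_prod => l _; apply: lcoef.
apply: ideal_power_ext (ideal_powerMl lprod (ideal_power_gen qA)) _ => z tz.
rewrite qpoly_shear ?As // (bigD1 s) //= {1}/F eqxx As [RHS]mulrCA.
congr (_ * _); rewrite -big_split; apply: eq_bigr => l ls.
by rewrite /F (negPf ls).
Qed.

Lemma bump_at_exp b s z : bump_at b z ^+ d =
  half_factor b s z * \prod_(j | j != s) (half_factor b j z * bump_at b z).
Proof.
have E : half_factor b s z * \prod_(j | j != s) half_factor b j z = bump_at b z.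
  by rewrite /bump_at [RHS](bigD1 s).
rewrite big_split /= mulrA E prodr_const.
rewrite -exprS; congr (_ ^+ _).
have := cardC1 s; rewrite card_ord => ->.
by rewrite (ltn_predK (ltn_ord s)).
Qed.

(** If [b i], take [s = i], as [z_i + 1] is the factor of column [s]. Otherwise
    take any [s] with [b s] and use
      [(z_i - 1) (1 - z_s) / 2 = - (1 + z_s z_i) + (1 + z_i) (1 + z_s) / 2]. *)
Lemma bump_at_linear b i : b != [ffun=> false] ->
  Gq 1 (fun z => (z i 0 - (-1) ^+ b i) * bump_at b z ^+ d).
Proof.
move=> b0; have [s bs] : exists s, b s.
  apply/existsP; apply: contraNT b0 => /existsPn bF.
  by apply/eqP/ffunP => j; rewrite ffunE; apply/negbTE.
have None_not j : None = Some j -> ~~ b j by [].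
case bi : (b i).
  have lh : laurent_fun (fun z => 2 * half_factor b i z).
    apply: laurentM (laurent_half_factor _ _).
    by apply: laurent_ext (laurentC _ 2) _ => z _; rewrite rmorph_nat.
  have := ideal_powerMl lh (box_ideal_core bi None_not).
  move/ideal_power_ext; apply=> z _; rewrite (bump_at_exp b i) mulr1.
  by rewrite expr1; field.
have bt j : Some i = Some j -> ~~ b j by move=> [<-]; rewrite bi.
have H1 := ideal_powerMl (laurentC _ (-2)) (box_ideal_core bs bt).
have li : laurent_fun (fun z : 'cV[K]_d => 1 + z i 0).
  exact: laurentD (laurent1 _ _) (laurentX _ _).
have H2 := ideal_powerMl li (box_ideal_core bs None_not).
apply: ideal_power_ext (ideal_powerD H1 H2) _ => z _.
rewrite (bump_at_exp b s) mulr1 {1}/half_factor bs rmorphN rmorph_nat.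
by rewrite expr0 expr1; field.
Qed.

Lemma bump_at_one : (0 < d)%N -> Gq 1 (fun z => bump_at [ffun=> false] z ^+ d).
Proof.
move=> hd; pose s := Ordinal hd.
have As : ~~ [ffun=> false] s by rewrite ffunE.
have qA : box_factor (@qpoly R d (shear s [ffun=> false] None)).
  by exists (shear s [ffun=> false] None) => //; apply: shear_admissible.
have lE := laurent_exp d.-1 (laurent_bump_at [ffun=> false]).
apply: ideal_power_ext (ideal_powerMl lE (ideal_power_gen qA)) _ => z tz.
have expd (x : K) : x ^+ d = x ^+ d.-1 * x by rewrite -exprSr (prednK hd).
rewrite qpoly_shear // expd; congr (_ * _).
rewrite /bump_at (bigD1 s) //=; congr (_ * _).
  by rewrite /half_factor ffunE expr0 mul1r mulr1.
by apply: eq_bigr => l _; rewrite /half_factor ffunE expr0 mul1r mulr1.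
Qed.

(** Relations for products of comaximal elements multiply: [v] is first made
    comaximal to [u ^ n], one factor [u] at a time, and then [v ^ m] likewise. *)
Lemma bezout_exp (u v : 'cV[K]_d -> K) n : laurent_fun u -> laurent_fun v ->
  (forall z, u z + v z = 1) ->
  exists pq : ('cV[K]_d -> K) * ('cV[K]_d -> K),
    [/\ laurent_fun pq.1, laurent_fun pq.2 &
      forall z, pq.1 z * u z ^+ n + pq.2 z * v z ^+ n = 1].
Proof.
move=> lu lv uv.
have [p [q [lp lq E]]] : exists p q, [/\ laurent_fun p, laurent_fun q &
    forall z, p z * u z ^+ n + q z * v z = 1].
  elim: n => [|n [p [q [lp lq E]]]].
    exists (fun=> 1), (fun=> 0); split; [exact: laurent1|exact: laurent0|].
    by move=> z; rewrite expr0 mul0r addr0 mulr1.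
  exists p, (fun z => q z + p z * u z ^+ n); split=> //.
    exact: laurentD lq (laurentM lp (laurent_exp _ lu)).
  by move=> z; rewrite -[RHS](E z) exprS; rewrite -[u z](addrK (v z)) uv; ring.
have /(_ n)[p' [q' [lp' lq' E']]] m : exists p' q',
    [/\ laurent_fun p', laurent_fun q' &
    forall z, p' z * u z ^+ n + q' z * v z ^+ m = 1].
  elim: m => [|m [p' [q' [lp' lq' E']]]].
    exists (fun=> 0), (fun=> 1); split; [exact: laurent0|exact: laurent1|].
    by move=> z; rewrite expr0 mul0r add0r mulr1.
  exists (fun z => p' z + q' z * v z ^+ m * p z), (fun z => q' z * q z).
  split=> //.
  - exact: laurentD lp' (laurentM (laurentM lq' (laurent_exp _ lv)) lp).
  - exact: laurentM.
  move=> z; rewrite -[RHS](E' z) -[X in _ = _ + X]mulr1 -(E z) exprS; ring.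
by exists (p', q').
Qed.

Lemma partition_of_unity n : exists c : {ffun 'I_d -> bool} -> 'cV[K]_d -> K,
  (forall b, laurent_fun (c b)) /\
  forall z, \sum_(b : {ffun 'I_d -> bool}) c b z * bump_at b z ^+ n = 1.
Proof.
pose u (c : bool) i z := half_factor [ffun=> c] i z.
have uv i z : u false i z + u true i z = 1.
  by rewrite /u /half_factor !ffunE expr0 expr1; field.
have /boolp.choice[pq Hpq] : forall i : 'I_d, exists pq : _ * _,
    [/\ laurent_fun pq.1, laurent_fun pq.2 & forall z,
      pq.1 z * u false i z ^+ n + pq.2 z * u true i z ^+ n = 1].
  move=> i; apply: bezout_exp (uv i); exact: laurent_half_factor.
pose F i (c : bool) z := if c then (pq i).2 z else (pq i).1 z.
exists (fun b z => \prod_i F i (b i) z); split=> [b|z].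
  apply: laurent_prod => i _; have [l1 l2 _] := Hpq i.
  by rewrite /F; case: (b i).
transitivity (\prod_i \sum_(c : bool) F i c z * u c i z ^+ n).
  rewrite bigA_distr_bigA; apply: eq_bigr => b _.
  rewrite /bump_at -prodrXl -big_split; apply: eq_bigr => i _ /=.
  by rewrite /u /half_factor ffunE.
rewrite big1 // => i _; have [_ _ E] := Hpq i.
by rewrite big_bool /= addrC; apply: E.
Qed.

(** The partition of unity splits [f] into multiples of the
    [bump_at b ^+ (d * k) * f], and each of these lies in the power of the box
    ideal by [bump_at_one] or [bump_at_linear]. *)
Lemma vanishing_box_ideal k f : (0 < d)%N -> laurent_fun f ->
  (forall b, b != [ffun=> false] -> ideal_power (linear_factor b) k f) ->
  Gq k f.
Proof.
move=> hd lf Vf; have [c [lc E]] := partition_of_unity (d * k).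
have H b : Gq k (fun z => f z * (bump_at b z ^+ d) ^+ k).
  have [->|b0] := eqVneq b [ffun=> false].
    exact/ideal_powerMl/ideal_powerX/bump_at_one.
  apply: ideal_power_subst (Vf b b0); first exact/laurent_exp/laurent_bump_at.
  by move=> g [i ->]; apply: bump_at_linear.
apply: ideal_power_ext (ideal_power_sum _ (fun b => ideal_powerMl (lc b) (H b))) _.
move=> z _; rewrite -[LHS]mulr1 -(E z) mulr_sumr.
by apply: eq_bigr => b _; rewrite exprM mulrCA.
Qed.

End BoxIdeal.

(** * Zeros of the box polynomials and normalized decompositions *)

Section SignPoints.
Variables (R : realType) (d : nat).
Notation K := (R[i] : numFieldType).
Implicit Types (f g : 'cV[K]_d -> K) (z : 'cV[K]_d).
Implicit Types (b : {ffun 'I_d -> bool}).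

Lemma monomial_sign_point b (alpha : 'cV[int]_d) :
  monomial (sign_point R b) alpha =
  (-1) ^ (\sum_(i < d) (b i : nat)%:Z * alpha i 0).
Proof.
have expD : {morph (fun n : int => (-1 : R[i]) ^ n) : m n / m + n >-> m * n}.
  by move=> m n; rewrite expfzDr // oppr_eq0 oner_eq0.
rewrite (big_morph _ expD (expr0z _)); apply: eq_bigr => i _.
by rewrite mxE exprnP exprz_exp.
Qed.

Lemma exprz_sign_odd (n : int) : ((-1) ^ n : R[i]) = (-1) ^+ odd `|n|%N.
Proof.
rewrite signr_odd; case: n => m; first by [].
by rewrite NegzE -exprnN abszN invr_sign.
Qed.

(** The exponents [Theta^T b] are not all even, because [Theta] is invertible
    modulo 2, and an odd exponent gives a factor [1 + (-1) = 0]. *)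
Lemma qpoly_sign_point b Theta : unimodular Theta -> b != [ffun=> false] ->
  qpoly Theta (sign_point R b) = 0.
Proof.
move=> /unimodular_unitmx uT b0; apply/eqP/negP => /negP.
rewrite prodf_seq_neq0 => /allP q_neq0.
pose v : 'rV[int]_d := \row_i (b i : nat)%:Z.
have even_v l : exists w : int, (v *m Theta) 0 l = 2 * w.
  have := q_neq0 l (mem_index_enum l); rewrite mulf_eq0 negb_or => /andP[+ _].
  rewrite monomial_sign_point exprz_sign_odd.
  have -> : \sum_(i < d) (b i : nat)%:Z * col l Theta i 0 = (v *m Theta) 0 l.
    by rewrite mxE; apply: eq_bigr => i _; rewrite !mxE.
  case o: (odd _); first by rewrite expr1 subrr eqxx.
  by move=> _; exists (((v *m Theta) 0 l)%R %/ 2)%Z; lia.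
have [w wE] := boolp.choice even_v.
have vE : v = 2 *: ((\row_l w l) *m invmx Theta).
  rewrite -[LHS](mulmxK uT) scalemxAl; congr (_ *m _).
  by apply/rowP => l; rewrite wE !mxE.
case/eqP: b0; apply/ffunP => i; rewrite ffunE.
have /rowP/(_ i) := vE; rewrite !mxE; case: (b i) => //.
by move: (\sum_(_ < _) _) => x; lia.
Qed.

Lemma sign_point1 : sign_point R [ffun _ : 'I_d => false] = const_mx 1.
Proof. by apply/colP => i; rewrite !mxE ffunE. Qed.

Lemma monomial_at1 (alpha : 'cV[int]_d) :
  monomial (const_mx 1 : 'cV[K]_d) alpha = 1.
Proof. by rewrite /monomial big1 // => i _; rewrite mxE exp1rz. Qed.

Lemma qpoly_at1 (Theta : 'M[int]_d) : qpoly Theta (const_mx 1 : 'cV[K]_d) = 1.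
Proof.
rewrite /qpoly big1 // => l _; rewrite monomial_at1.
by rewrite -[1 + 1]/(2%:R) divff // pnatr_eq0.
Qed.

Lemma sign_pointP (eps : 'cV[K]_d) : (forall i, eps i 0 = 1 \/ eps i 0 = -1) ->
  exists b, eps = sign_point R b.
Proof.
move=> epsP; exists [ffun i => eps i 0 == -1]; apply/colP => i.
rewrite mxE ffunE; have n1 : (1 == -1 :> R[i]) = false.
  by rewrite -subr_eq0 opprK -[1 + 1]/(2%:R) pnatr_eq0.
by have [->|->] := epsP i; rewrite ?n1 ?eqxx.
Qed.

(** An arbitrary finite index type makes sums of decompositions disjoint unions.
    A cofactor [f] with value [r] at the point 1 is split as
    [1 * (f - r + 1) + (r - 1) * 1]. *)
Lemma box_ideal_normal_form k f : ideal_power (@box_factor R d) k f ->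
  exists (I : finType) (lambda : I -> R) (sigma : I -> laurent R d)
         (Theta : I -> 'I_k -> 'M[int]_d),
    [/\ forall i l, admissible (Theta i l),
        forall i, symbol (sigma i) (const_mx 1) = 1
      & forall z : 'cV[K]_d, torus z -> f z =
          \sum_i (lambda i)%:C * symbol (sigma i) z
                 * \prod_(l < k) qpoly (Theta i l) z].
Proof.
have torus1 : torus (const_mx 1 : 'cV[K]_d).
  by move=> i; rewrite mxE oner_neq0.
elim=> {k f}.
- move=> f lf; have [r [fr _]] := point_ideal_const [ffun=> false] lf.
  rewrite sign_point1 in fr.
  have [u uE] := laurent_funP (laurentD lf (laurentC d (1 - r))).
  have [v vE] := laurent_funP (laurent1 R d).
  exists bool, (fun c => if c then 1 else r - 1), (fun c => if c then u else v).
  exists (fun _ l => 1%:M); split; first by move=> _ [].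
    by case; rewrite -?uE -?vE // fr -rmorphD addrC subrK rmorph1.
  move=> z tz; rewrite big_bool !big_ord0 -uE // -vE // !mulr1 rmorph1 mul1r.
  by rewrite /= -addrA -rmorphD /= subrKA subrr addr0.
- move=> k; exists void, (fun=> 0), (fun=> [fsfun]), (fun _ _ => 1%:M).
  by split=> [[]|[]|z _]; rewrite big1 // => -[].
- move=> k g f [ Theta0 T0 ->] _ [I [lambda [sigma [ Theta [adm s1 fE]]]]].
  exists I, lambda, sigma,
    (fun i l => if unlift ord0 l is Some l' then Theta i l' else Theta0).
  split=> // [i l|z tz]; first by case: unliftP.
  rewrite fE // mulr_sumr; apply: eq_bigr => i _.
  rewrite big_ord_recl unlift_none mulrCA; congr (_ * (_ * _)).
  by apply: eq_bigr => l _; rewrite liftK.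
- move=> k f1 f2 _ [I1 [lambda1 [sigma1 [ Theta1 [adm1 s1 f1E]]]]] _.
  move=> [I2 [lambda2 [sigma2 [ Theta2 [adm2 s2 f2E]]]]].
  exists (I1 + I2)%type,
    (fun i => match i with inl i => lambda1 i | inr i => lambda2 i end),
    (fun i => match i with inl i => sigma1 i | inr i => sigma2 i end),
    (fun i => match i with inl i => Theta1 i | inr i => Theta2 i end).
  by split=> [[i|i] l|[]|z tz] //; rewrite big_sumType f1E ?f2E.
- move=> k f1 f2 _ [I [lambda [sigma [ Theta [adm s1 fE]]]]] e.
  by exists I, lambda, sigma, Theta; split=> // z tz; rewrite e // fE.
Qed.

End SignPoints.

Theorem theoremB (R : realType) (d k : nat) (hd : (1 <= d)%N) (hk : (1 <= k)%N)
    (a : laurent R d) (ha : convergent a) :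
  condZ k a <->
  exists (n : nat) (lambda : 'I_n -> R) (sigma : 'I_n -> laurent R d)
         (Theta : 'I_n -> 'I_k -> 'M[int]_d),
    [/\ forall j l, submatrix_of_X (Theta j l) /\ unimodular (Theta j l),
        forall j, symbol (sigma j) (const_mx 1) = 1,
        \sum_(j < n) lambda j = 1
      & forall z : 'cV[R[i]]_d, torus z ->
          symbol a z =
          \sum_(j < n) (lambda j)%:C * symbol (sigma j) z
                       * (2 ^+ d * \prod_(l < k) qpoly (Theta j l) z)].
Proof.
have torus1 : torus (const_mx 1 : 'cV[R[i]]_d).
  by move=> i; rewrite mxE oner_neq0.
have two_neq0 : 2 ^+ d != 0 :> R[i] by rewrite expf_neq0 // pnatr_eq0.
split=> [[a1 aV]|[n [lambda [sigma [ Theta [adm s1 suml aE]]]]]].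
  have la := laurentM (laurentC d (2 ^- d)) (laurent_symbol a).
  have /box_ideal_normal_form[I [lambda [sigma [ Theta [adm s1 fE]]]]] :
      ideal_power (@box_factor R d) k (fun z => (2 ^- d)%:C * symbol a z).
    apply: vanishing_box_ideal => // b b0.
    apply: ideal_powerMl; first exact: laurentC.
    apply/point_ideal_mixed_partial; first exact: laurent_symbol.
    move=> j jk; apply: aV => // [i|].
      by rewrite mxE; case: (b i); [right|left].
    rewrite -sign_point1 => /colP bE; case/eqP: b0; apply/ffunP => i.
    have /eqP := bE i; rewrite !mxE ffunE; case: (b i) => //.
    by rewrite expr1 -subr_eq0 -opprD oppr_eq0 -[1 + 1]/(2%:R) pnatr_eq0.
  have two_inv : (2 ^- d)%:C = 2 ^- d :> R[i].
    by rewrite fmorphV rmorphXn rmorph_nat.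
  exists #|I|, (fun j => lambda (enum_val j)), (fun j => sigma (enum_val j)),
    (fun j => Theta (enum_val j)); split=> [j l|//||]; first exact: adm.
    have := fE _ torus1; rewrite a1 two_inv mulVf // => E.
    apply: complexI; rewrite rmorph1 [RHS]E rmorph_sum /=.
    rewrite -(big_enum_val (fun i => (lambda i)%:C)) /=.
    apply: eq_bigr => i _; rewrite s1 big1 ?mulr1 // => l _; exact: qpoly_at1.
  move=> z tz; rewrite -[LHS](mulVKf two_neq0) -two_inv fE // mulr_sumr.
  rewrite -(big_enum_val (fun i => (lambda i)%:C * symbol (sigma i) z *
    (2 ^+ d * \prod_(l < k) qpoly (Theta i l) z))) /=.
  by apply: eq_bigr => i _; rewrite mulrCA.
split.
  rewrite aE // (eq_bigr (fun j => (lambda j)%:C * 2 ^+ d)); last first.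
    by move=> j _; rewrite s1 big1 ?mulr1 // => l _; apply: qpoly_at1.
  by rewrite -mulr_suml -rmorph_sum suml rmorph1 mul1r.
move=> eps /sign_pointP[b ->] b1.
have b0 : b != [ffun=> false].
  by apply/eqP => bF; apply: b1; rewrite bF sign_point1.
apply/point_ideal_mixed_partial; first exact: laurent_symbol.
apply: ideal_power_ext aE; apply: ideal_power_sum => j.
have lls := laurentM (laurentM (laurentC d (lambda j))
  (laurent_symbol (sigma j))) (laurentC d (2 ^+ d)).
have Iq : ideal_power (@linear_factor R d b) k
    (fun z => \prod_(l < k) qpoly (Theta j l) z).
  apply: ideal_power_prod => l; apply: point_ideal1.
    by apply: box_factor_laurent; exists (Theta j l).
  exact: qpoly_sign_point (adm j l).2 b0.
apply: ideal_power_ext (ideal_powerMl lls Iq) _ => z _.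
by rewrite -!mulrA rmorphXn rmorph_nat.
Qed.
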